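(* Let $X\in M_n(\mathbb{C})$ be unitarily irreducible and rotationally invariant, so that $\mathbb{C}^n=H_1\oplus\cdots\oplus H_k$ (orthogonal) with $X(H_1)=\{0\}$ and $X(H_i)\subseteq H_{i-1}$ for $2\le i\le k$. Let $\lambda_j$ be a simple eigenvalue of $H_X(\theta)$ (which, by rotational invariance, is an eigenvalue of $H_X(\theta)$ for every $\theta$, and is simple for every $\theta$), and let $y^{(j)}(\theta)$ be a unit eigenvector of $H_X(\theta)$ for $\lambda_j$ depending real-analytically on $\theta\in\mathbb{R}$. Then there exist nonnegative numbers $c_1^{(j)},\dots,c_k^{(j)}$ with $\sum_{m=1}^k c_m^{(j)}=1$, defining $p_j(z)=\sum_{m=1}^k c_m^{(j)}z^{m-1}$, and a real-analytic real-valued function $\psi$ such that $$\langle y^{(j)}(\theta),y^{(j)}(\phi)\rangle=p_j\bigl(e^{i(\phi-\theta)}\bigr)e^{i(\psi(\phi)-\psi(\theta))}\qquad(\theta,\phi\in\mathbb{R}).$$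
   Context: $X\in M_n$ is rotationally invariant if $X$ and $e^{i\theta}X$ are unitarily similar for every $\theta\in\mathbb{R}$. A unitarily irreducible matrix is one not unitarily similar to a direct sum of two smaller matrices; by a theorem of Li and Tsing, a unitarily irreducible matrix is rotationally invariant iff it is unitarily similar to a block shift, i.e. there is an orthogonal decomposition as in the claim. $H_X(\theta)=\operatorname{Re}(e^{-i\theta}X)=\frac12(e^{-i\theta}X+e^{i\theta}X^* )$. The inner product $\langle\cdot,\cdot\rangle$ is linear in the first argument. *)

(* Defs.v *)
From HB Require Import structures.
From mathcomp Require Import all_boot all_order all_algebra.
From mathcomp Require Import all_classical all_reals all_analysis.
From mathcomp Require Import complex.
Set Implicit Arguments. Unset Strict Implicit. Unset Printing Implicit Defensive.
Import Order.TTheory GRing.Theory Num.Theory.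
Import numFieldTopology.Exports numFieldNormedType.Exports.
Local Open Scope ring_scope.
Local Open Scope classical_set_scope.
Local Open Scope ring_scope.
Local Open Scope complex_scope.

Section Defs.
Variable R : realType.
Local Notation C := R[i].

(* e^{i t} *)
Definition expi (t : R) : C := (cos t) +i* (sin t).

(* conjugate transpose *)
Definition mxadj m n (A : 'M[C]_(m, n)) : 'M[C]_(n, m) := (map_mx (fun z : C => z^*) A)^T.

(* <u, w> = sum_l u_l * conj(w_l), linear in the first argument *)
Definition cdot n (u w : 'cV[C]_n) : C := \sum_(l < n) u l 0 * (w l 0)^*.

Definition unitarymx n (U : 'M[C]_n) : Prop := U *m mxadj U = 1%:M.

Definition unitarily_similar n (A B : 'M[C]_n) : Prop :=
  exists U : 'M[C]_n, unitarymx U /\ B = U *m A *m mxadj U.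

(* not unitarily similar to a direct sum of two smaller (nonempty) matrices *)
Definition unitarily_irreducible n (X : 'M[C]_n) : Prop :=
  ~ exists (p q : nat) (E : (p.+1 + q.+1)%N = n)
        (A : 'M[C]_(p.+1)) (B : 'M[C]_(q.+1)),
      unitarily_similar X (castmx (E, E) (block_mx A 0 0 B)).

Definition rotationally_invariant n (X : 'M[C]_n) : Prop :=
  forall t : R, unitarily_similar X (expi t *: X).

(* H_X(t) = (e^{-it} X + e^{it} X^* ) / 2 *)
Definition HX n (X : 'M[C]_n) (t : R) : 'M[C]_n :=
  (2%:R)^-1 *: (expi (- t) *: X + expi t *: mxadj X).

(* membership of a column vector in the subspace spanned by the rows of A *)
Definition inspace n (A : 'M[C]_n) (v : 'cV[C]_n) : bool := (v^T <= A)%MS.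

(* simple eigenvalue: root of multiplicity one of the characteristic polynomial *)
Definition simple_eigenvalue n (A : 'M[C]_n) (l : C) : Prop :=
  mup l (char_poly A) = 1%N.

(* real-analytic functions: locally sums of convergent power series *)
Definition real_analyticR (f : R -> R) : Prop :=
  forall t0 : R, exists2 r : R, 0 < r &
    exists a : nat -> R, forall t : R, `|t - t0| < r ->
      (fun N : nat => \sum_(k < N) a k * (t - t0) ^+ k) @ \oo --> f t.

Definition real_analyticC (f : R -> C) : Prop :=
  forall t0 : R, exists2 r : R, 0 < r &
    exists a : nat -> C, forall t : R, `|t - t0| < r ->
      (fun N : nat => \sum_(k < N) a k * ((t - t0) ^+ k)%:C) @ \oo --> (f t : Num.NumField.sort (R[i] : numFieldType)).

(* a vector-valued function is real analytic iff each coordinate is *)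
Definition real_analyticV n (y : R -> 'cV[C]_n) : Prop :=
  forall l : 'I_n, real_analyticC (fun t => y t l 0).

End Defs.

(* Main.v *)
Require Import Defs.
From HB Require Import structures.
From mathcomp Require Import all_boot all_order all_algebra.
From mathcomp Require Import all_classical all_reals all_analysis.
From mathcomp Require Import complex ring lra.
Import Order.TTheory GRing.Theory Num.Theory.
Import numFieldTopology.Exports numFieldNormedType.Exports.
Local Open Scope ring_scope.
Local Open Scope complex_scope.

(* Let Q_m be the orthogonal projection onto the m-th block and
   D(t) = \sum_m e^{imt} Q_m.  Since X lowers the block index by one,
   D(t) H_X(s) D(-t) = H_X(s + t), so simplicity of lambda at theta0 forces
   y(t) = s(t) D(t - theta0) y(theta0) with |s(t)| = 1.  Hence
   <y(t), y(t')> = s(t) conj(s(t')) \sum_m e^{im(t - t')} |Q_m y(theta0)|^2.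
   The powers run in the direction opposite to the one claimed, so the
   coefficients are read backwards and e^{i(k-1)(t - t')} goes into the phase.
   Picking j with Q_j y(theta0) <> 0, the function s(t) e^{ij(t - theta0)} is a
   fixed linear combination of the coordinates of y(t), hence real-analytic of
   modulus one; writing it as a + ib, its phase is a primitive of a b' - b a',
   and a primitive of a real-analytic function is real-analytic. *)

(** * Cauchy products of absolutely convergent series *)

Section CauchyProduct.
Local Open Scope classical_set_scope.
Local Open Scope ring_scope.
Local Open Scope complex_scope.
Variable R : realType.
Implicit Types u v : R^nat.

Definition cauchy_prod u v : R^nat := fun n => \sum_(i < n.+1) u i * v (n - i)%N.

(** The pairs with i + j < N are summed with i fixed, which leaves j < N - i. *)
Lemma series_cauchy_prod u v N :
  series (cauchy_prod u v) N = \sum_(i < N) u i * series v (N - i)%N.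
Proof.
elim: N => [|N IH]; first by rewrite /series /= !big_mkord !big_ord0.
rewrite seriesSr IH big_ord_recr /= subSn // subnn seriesSr.
rewrite [series v 0]/series /= big_geq // add0r.
rewrite /cauchy_prod big_ord_recr /= subnn addrA -big_split /=; congr (_ + _).
by apply: eq_bigr => i _; rewrite subSn ?(ltnW (ltn_ord i)) // seriesSr mulrDr.
Qed.

(** The square i, j < N/2 lies inside the triangle i + j < N, and the remaining terms are
    nonnegative. *)
Lemma half_series_le_cauchy_prod u v N :
  (forall n, 0 <= u n) -> (forall n, 0 <= v n) ->
  series u N./2 * series v N./2 <= series (cauchy_prod u v) N.
Proof.
move=> u0 v0; have v_nd : nondecreasing_seq (series v).
  by apply: nondecreasing_series => n _ _; exact: v0.
have N2 : (N./2 <= N)%N by rewrite leq_half_double -addnn leqW ?leq_addr.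
rewrite series_cauchy_prod {1}/series /= big_mkord.
rewrite (big_ord_widen _ _ N2) mulr_suml [leRHS](bigID (fun i : 'I_N => (i < N./2)%N)) /=.
rewrite -[leLHS]addr0 lerD //.
  apply: ler_sum => i iN; apply: ler_wpM2l => //; apply: v_nd.
  rewrite leq_subRL ?(ltnW (ltn_ord i)) //.
  apply: leq_trans (leq_add (ltnW iN) (leqnn _)) _.
  by rewrite addnn -[leqRHS]odd_double_half leq_addl.
apply: sumr_ge0 => i _; apply: mulr_ge0 => //.
by apply: sumr_ge0.
Qed.

Lemma half_cvgny : (fun N : nat => N./2) @ \oo --> \oo.
Proof.
apply/cvgnyPge => A; exists A.*2 => // N /= AN.
by rewrite geq_half_double.
Qed.

(** Square partial sums tend to l l', so it suffices that square minus triangle tends to 0. Its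
    modulus is at most the same difference for |u| and |v|, hence at most full square minus half
    square, and these two have the same limit. *)
Lemma cvg_cauchy_prod u v (l l' : R) :
  cvgn [normed series u] -> cvgn [normed series v] ->
  series u @ \oo --> l -> series v @ \oo --> l' ->
  series (cauchy_prod u v) @ \oo --> l * l'.
Proof.
move=> cu cv ul vl'.
pose u' n := `|u n|; pose v' n := `|v n|.
pose d N := series u' N * series v' N - series u' N./2 * series v' N./2.
have d0 : d @ \oo --> (0 : R).
  have uv' : (fun N => series u' N * series v' N) @ \oo -->
      limn (series u') * limn (series v') by exact: cvgM.
  rewrite -(subrr (limn (series u') * limn (series v'))).
  by apply: cvgB => //; apply: cvg_comp half_cvgny uv'.
have bnd N : `|series u N * series v N - series (cauchy_prod u v) N| <= d N.
  (* Square minus triangle is a combination of tails of [b], so the triangle inequality can be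
     applied term by term. *)
  have eqE (a b : R^nat) : series a N * series b N - series (cauchy_prod a b) N =
      \sum_(i < N) a i * (series b N - series b (N - i)%N).
    rewrite series_cauchy_prod {1}/series /= big_mkord mulr_suml -sumrB.
    by apply: eq_bigr => i _; rewrite mulrBr.
  apply: (@le_trans _ _ (series u' N * series v' N - series (cauchy_prod u' v') N)).
    rewrite !eqE; apply: le_trans (ler_norm_sum _ _ _) _; apply: ler_sum => i _.
    rewrite normrM ler_wpM2l //.
    rewrite !sub_series leq_subr; exact: ler_norm_sum.
  by rewrite lerD2l lerN2; apply: half_series_le_cauchy_prod => n; exact: normr_ge0.
have uv : (fun N => series u N * series v N) @ \oo --> l * l' by exact: cvgM.
suff e0 : (fun N => series u N * series v N - series (cauchy_prod u v) N) @ \oo -->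
    (0 : R).
  have -> : series (cauchy_prod u v) = fun N => series u N * series v N -
      (series u N * series v N - series (cauchy_prod u v) N).
    by apply/funext => N; rewrite subKr.
  by rewrite -[l * l']subr0; exact: cvgB.
apply/norm_cvg0P; apply: (squeeze_cvgr _ (cvg_cst 0) d0).
by apply: nearW => N; rewrite normr_ge0 bnd.
Qed.

End CauchyProduct.

(** * Real-analytic functions of a real variable: algebra, derivatives, primitives *)

Section RealAnalytic.
Local Open Scope classical_set_scope.
Local Open Scope ring_scope.
Local Open Scope complex_scope.
Variable R : realType.
Implicit Types (f g h : R -> R) (a b : nat -> R).

Lemma cvgn_seriesS (u : R^nat) :
  cvgn (series (fun n => u n.+1)) = cvgn (series u).
Proof.
rewrite -(is_cvg_series_restrict 1 u).
have sE : series (fun n => u n.+1) = fun n => \sum_(1 <= k < n.+1) u k.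
  by apply/funext => n; rewrite /series /= big_add1.
apply/propeqP; split.
  rewrite sE => /cvg_ex [l ul]; apply/cvg_ex; exists l.
  by rewrite -cvg_shiftS.
move=> /cvg_ex [l ul]; apply/cvg_ex; exists l.
by rewrite sE; move: ul; rewrite -cvg_shiftS.
Qed.

Lemma is_cvg_pseries_normed a (K x : R) :
  cvgn (pseries a K) -> `|x| < `|K| -> cvgn [normed pseries a x].
Proof.
move=> aK xK; have := @is_cvg_pseries_inside_norm R a K `|x| aK.
rewrite normr_id => /(_ xK).
suff -> : pseries (fun n => `|a n|) `|x| = [normed pseries a x] by [].
by apply/funext => n; apply: eq_bigr => i _ /=; rewrite normrM normrX.
Qed.

(** Take |x| < r < |K|. Then r^{n+1} - |x|^{n+1} is r - |x| times a sum of n + 1 products, each at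
    least |x|^n, so the derived series is dominated by a multiple of the series of |a_{n+1}|
    r^{n+1}. *)
Lemma is_cvg_pseries_diffs a (K x : R) :
  cvgn (pseries a K) -> `|x| < `|K| -> cvgn (pseries (pseries_diffs a) x).
Proof.
move=> aK xK; pose r := (`|x| + `|K|) / 2.
have xr : `|x| < r by rewrite /r midf_lt.
have r0 : 0 <= r by apply: le_trans (normr_ge0 x) (ltW xr).
have rK : `|r| < `|K| by rewrite ger0_norm // /r midf_lt.
have := is_cvg_pseries_normed a K r aK rK.
rewrite -cvgn_seriesS => /(@is_cvg_seriesZ _ _ (r - `|x|)^-1) cr.
apply: normed_cvg; apply: (series_le_cvg _ _ _ cr) => n //=.
  by rewrite mulr_ge0 // invr_ge0 subr_ge0 ltW.
rewrite /pseries_diffs /GRing.scale /= ler_pdivlMl ?subr_gt0 //.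
rewrite !normrM !normrX normr_nat (ger0_norm r0).
rewrite [n.+1%:R * _]mulrC -mulrA mulrCA ler_wpM2l //.
have -> : r ^+ n.+1 = r ^+ n.+1 - `|x| ^+ n.+1 + `|x| ^+ n.+1 by rewrite subrK.
apply: ler_wpDr; first exact: exprn_ge0.
(* (r - |x|) (n + 1) |x|^n <= r^{n+1} - |x|^{n+1} *)
rewrite subrXX ler_wpM2l ?subr_ge0 ?(ltW xr) //.
rewrite mulr_natl -[n.+1 in leLHS]card_ord -sumr_const; apply: ler_sum => i _ /=.
have -> : `|x| ^+ n = `|x| ^+ (n - i) * `|x| ^+ i by rewrite -exprD subnK // -ltnS.
rewrite ler_wpM2r ?exprn_ge0 //.
by rewrite lerXn2r ?nnegrE ?normr_ge0 // ltW.
Qed.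

Lemma is_derive_pseries a (r x : R) :
  (forall z, `|z| < r -> cvgn (pseries a z)) -> `|x| < r ->
  is_derive x (1 : R) (fun z => limn (pseries a z))
    (limn (pseries (pseries_diffs a) x)).
Proof.
(* Termwise differentiation asks for the series and its first two derived series to converge at
   [K1]. Each derivation shrinks the radius slightly, hence three points between |x| and r. *)
move=> acvg xr; pose K1 := (`|x| + r) / 2; pose K2 := (K1 + r) / 2.
pose K3 := (K2 + r) / 2.
have x1 : `|x| < K1 by rewrite midf_lt.
have K1r : K1 < r by rewrite midf_lt.
have K12 : K1 < K2 by rewrite midf_lt.
have K2r : K2 < r by rewrite midf_lt.
have K23 : K2 < K3 by rewrite midf_lt.
have K3r : K3 < r by rewrite midf_lt.
have K10 : 0 <= K1 := le_trans (normr_ge0 x) (ltW x1).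
have K20 : 0 <= K2 := le_trans K10 (ltW K12).
have K30 : 0 <= K3 := le_trans K20 (ltW K23).
have a3 : cvgn (pseries a K3) by apply: acvg; rewrite ger0_norm.
have a2 : cvgn (pseries (pseries_diffs a) K2).
  by apply: is_cvg_pseries_diffs a3 _; rewrite !ger0_norm.
apply: (@pseries_snd_diffs _ a K1) => //.
- by apply: acvg; rewrite ger0_norm.
- by apply: is_cvg_pseries_diffs a3 _; rewrite !ger0_norm // (lt_trans K12).
- by apply: is_cvg_pseries_diffs a2 _; rewrite !ger0_norm.
- by rewrite (ger0_norm K10).
Qed.

(** Passing to the displacement x = t - t0 turns the local expansion into a [pseries], the form used
    by the power series lemmas. *)
Lemma real_analyticP f : real_analyticR f <->
  forall t0, exists2 r : R, 0 < r & exists a, forall x, `|x| < r ->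
    pseries a x @ \oo --> f (t0 + x).
Proof.
have sE a x : (fun N : nat => \sum_(k < N) a k * x ^+ k) = pseries a x.
  by apply/funext => N; rewrite /pseries /series /= big_mkord.
split=> fa t0; have [r r0 [a ar]] := fa t0; exists r => //; exists a => x xr.
  have := ar (t0 + x); rewrite [_ - t0]addrAC subrr add0r sE; exact.
by have := ar (x - t0) xr; rewrite [t0 + _]addrC subrK -sE.
Qed.

Lemma real_analytic_ext f g : f =1 g -> real_analyticR f -> real_analyticR g.
Proof. by move=> /funext ->. Qed.

Lemma real_analytic_cst (c : R) : real_analyticR (fun=> c).
Proof.
apply/real_analyticP => t0; exists 1 => //; exists (fun n => c *+ (n == 0)) => x _.
rewrite -cvg_shiftS; apply: cvg_near_cst; apply: nearW => n.
rewrite /pseries /series /= big_nat_recl //= expr0 mulr1 big1 ?addr0 // => i _.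
by rewrite mul0r.
Qed.

Lemma real_analyticD f g : real_analyticR f -> real_analyticR g ->
  real_analyticR (fun t => f t + g t).
Proof.
move=> /real_analyticP fa /real_analyticP ga; apply/real_analyticP => t0.
have [r r0 [a ar]] := fa t0; have [s s0 [b bs]] := ga t0.
exists (Num.min r s); first by rewrite lt_min r0.
exists (fun n => a n + b n) => x; rewrite lt_min => /andP[xr xs].
have -> : pseries (fun n => a n + b n) x = (fun n => pseries a x n + pseries b x n).
  apply/funext => n; rewrite /pseries /series /= -big_split /=.
  by apply: eq_bigr => i _; rewrite mulrDl.
exact: cvgD (ar _ xr) (bs _ xs).
Qed.

Lemma real_analyticM f g : real_analyticR f -> real_analyticR g ->
  real_analyticR (fun t => f t * g t).
Proof.
move=> /real_analyticP fa /real_analyticP ga; apply/real_analyticP => t0.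
have [r r0 [a ar]] := fa t0; have [s s0 [b bs]] := ga t0.
exists (Num.min r s); first by rewrite lt_min r0.
exists (cauchy_prod R a b) => x xm.
have [xr xs] : `|x| < r /\ `|x| < s by apply/andP; rewrite -lt_min.
have -> : pseries (cauchy_prod R a b) x =
    series (cauchy_prod R (fun n => a n * x ^+ n) (fun n => b n * x ^+ n)).
  rewrite /pseries; congr series; apply/funext => n /=; rewrite /cauchy_prod mulr_suml.
  apply: eq_bigr => i _; rewrite mulrACA -exprD subnKC //.
  by rewrite -ltnS.
(* Convergence at the midpoint of |x| and q gives the absolute convergence at x that the Cauchy
   product requires. *)
have normed c q : `|x| < q -> (forall z, `|z| < q -> cvgn (pseries c z)) ->
    cvgn [normed pseries c x].
  move=> xq cq; have qx : `|x| < (`|x| + q) / 2 by rewrite midf_lt.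
  have mid0 : 0 <= (`|x| + q) / 2 := le_trans (normr_ge0 x) (ltW qx).
  apply: (@is_cvg_pseries_normed c ((`|x| + q) / 2)); last by rewrite (ger0_norm mid0).
  by apply: cq; rewrite ger0_norm // midf_lt.
apply: cvg_cauchy_prod; [| |exact: ar|exact: bs].
- by apply: (normed a r) => // z zr; apply/cvg_ex; exists (f (t0 + z)); exact: ar.
- by apply: (normed b s) => // z zs; apply/cvg_ex; exists (g (t0 + z)); exact: bs.
Qed.

Lemma real_analytic_sum n (f : 'I_n -> R -> R) :
  (forall i, real_analyticR (f i)) -> real_analyticR (fun t => \sum_i f i t).
Proof.
move=> fa; elim: n f fa => [|n IH] f fa.
  by apply: real_analytic_ext (real_analytic_cst 0) => t; rewrite big_ord0.
apply: (@real_analytic_ext (fun t => f ord0 t + \sum_i f (lift ord0 i) t)).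
  by move=> t; rewrite big_ord_recl.
by apply: real_analyticD => //; apply: IH.
Qed.

Lemma real_analytic_derive f : real_analyticR f ->
  exists2 f' : R -> R, real_analyticR f' & forall t : R, is_derive t 1 f (f' t).
Proof.
move=> /real_analyticP fa.
have fD (t0 r : R) a : (forall x, `|x| < r -> pseries a x @ \oo --> f (t0 + x)) ->
    forall x, `|x| < r ->
    is_derive (t0 + x) 1 f (limn (pseries (pseries_diffs a) x)).
  move=> ar x xr.
  have ac z : `|z| < r -> cvgn (pseries a z).
    by move=> zr; apply/cvg_ex; exists (f (t0 + z)); exact: ar.
  have D := is_derive_pseries _ _ _ ac xr.
  have xE : x = (t0 + x) - t0 by rewrite addrAC subrr add0r.
  have := @is_derive1_comp R (fun z => limn (pseries a z)) (fun t => t - t0)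
    (t0 + x) (limn (pseries (pseries_diffs a) x)) 1.
  rewrite -xE mulr1 => /(_ D) D'.
  have {}D' : is_derive (t0 + x) 1 (fun t => limn (pseries a (t - t0)))
      (limn (pseries (pseries_diffs a) x)).
    apply: D'; rewrite -[X in is_derive _ _ _ X]subr0.
    by apply: is_deriveB.
  apply: near_eq_is_derive D'.
  have xr' : 0 < r - `|x| by rewrite subr_gt0.
  near=> t; have tr : `|t - t0| < r.
    have -> : t - t0 = (t - (t0 + x)) + x by rewrite opprD addrA subrK.
    apply: le_lt_trans (ler_normD _ _) _; rewrite -ltrBrDr distrC.
    near: t; exact: cvgr_dist_lt.
  by have /cvg_lim := ar _ tr; rewrite [t0 + _]addrC subrK => ->.
(* The local derived series must be glued into one function; ['D_1 f] is global and agrees with each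
   of them on its disc. *)
exists (fun t => 'D_1 f t) => [|t].
  apply/real_analyticP => t0; have [r r0 [a ar]] := fa t0; exists r => //.
  exists (pseries_diffs a) => x xr.
  have D := fD _ _ _ ar x xr; rewrite (@derive_val _ _ _ _ _ _ _ D).
  have xm : `|x| < (`|x| + r) / 2 by rewrite midf_lt.
  have m0 := le_trans (normr_ge0 x) (ltW xm).
  apply: (@is_cvg_pseries_diffs a ((`|x| + r) / 2)); last by rewrite (ger0_norm m0).
  apply/cvg_ex; eexists; apply: ar; by rewrite ger0_norm // midf_lt.
have [r r0 [a ar]] := fa t.
have := fD _ _ _ ar 0; rewrite normr0 => /(_ r0); rewrite addr0 => D.
by rewrite (@derive_val _ _ _ _ _ _ _ D).
Unshelve. all: by end_near.
Qed.

(** Mean value theorem. The derivative is prescribed only between the two points, in either order,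
    because the lemma serves functions whose derivative is known only on a half-line or a disc. *)
Lemma derive0_eq f (x y : R) :
  (forall z : R, Num.min x y <= z <= Num.max x y -> is_derive z 1 f 0) -> f x = f y.
Proof.
wlog xy : x y / x <= y => [wl fD|].
  have [xy|/ltW yx] := leP x y; first exact: wl.
  by apply/esym/wl => // z; rewrite minC maxC; exact: fD.
rewrite min_l // max_r // => fD.
have [| |c _] := @MVT_segment R f (fun=> 0) x y xy.
- by move=> z; rewrite in_itv /= => /andP[xz zy]; apply: fD; rewrite !ltW.
- apply: derivable_within_continuous => z; rewrite in_itv /= => xzy.
  exact: (@ex_derive _ _ _ _ _ _ _ (fD z xzy)).
by rewrite mul0r => /subr0_eq.
Qed.

Lemma continuous_antiderivative h : continuous h ->
  exists F : R -> R, forall t : R, is_derive t 1 F (h t).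
Proof.
move=> hc; (* Integrals from a variable base point A < min(0, t), as [A, t] only
   gives a primitive to the right of A; they agree up to the constant I A 0. *)
pose I A t := \int[@lebesgue_measure R]_(s in `[A, t]) h s.
have ID (A t : R) : A < t -> is_derive t 1 (I A) (h t).
  move=> At; have [|||] := @continuous_FTC1_closed R h A t (t + 1) _ _ At.
  - by rewrite ltrDl.
  - apply: continuous_compact_integrable; first exact: segment_compact.
    by apply: continuous_subspaceT.
  - exact: hc.
  by move=> d <-; rewrite derive1E; exact: derivableP.
pose P A t := I A t - I A 0.
have PE A B t : A < 0 -> A < t -> B < 0 -> B < t -> P A t = P B t.
  move=> A0 At B0 Bt; rewrite /P.
  have : I A t - I B t = I A 0 - I B 0.
    apply: (@derive0_eq (fun t => I A t - I B t)) => z /andP[mz _].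
    rewrite -(subrr (h z)); apply: is_deriveB; apply: ID; apply: lt_le_trans mz.
      by rewrite lt_min At.
    by rewrite lt_min Bt.
  by lra.
(* The base point - |t| - 1 lies to the left of both 0 and t. To differentiate at t it is frozen at
   - |t| - 2, which is admissible for every s within distance 1 of t. *)
exists (fun t => P (- `|t| - 1) t) => t.
have PD : is_derive t 1 (P (- `|t| - 2)) (h t).
  rewrite -[h t]subr0; apply: is_deriveB; apply: ID.
  by have := ler_norm (- t); rewrite normrN; lra.
apply: near_eq_is_derive PD; near=> s.
have st : `|t - s| < 1 by near: s; exact: cvgr_dist_lt.
have s0 := normr_ge0 s; have t0 := normr_ge0 t.
have s1 := ler_norm (- s); rewrite normrN in s1.
have := ler_normD (s - t) t; rewrite subrK distrC => st'.
by apply: PE; lra.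
Unshelve. all: by end_near.
Qed.

Lemma real_analytic_primitive h F : real_analyticR h ->
  (forall t : R, is_derive t 1 F (h t)) -> real_analyticR F.
Proof.
move=> /real_analyticP ha FD; apply/real_analyticP => t0.
have [r r0 [a ar]] := ha t0; exists r => //.
(* The expansion of [h] integrated term by term, with the value of [F] at the centre as constant
   term. *)
pose b n := if n is m.+1 then a m / m.+1%:R else F t0.
have bE : pseries_diffs b = a.
  by apply/funext => n; rewrite /pseries_diffs /b mulrC divfK.
have ac z : `|z| < r -> cvgn (pseries a z).
  by move=> zr; apply/cvg_ex; exists (h (t0 + z)); exact: ar.
(* Comparison: |b_{n+1} z^{n+1}| = |z| |a_n z^n| / (n + 1). *)
have bc z : `|z| < r -> cvgn (pseries b z).
  move=> zr; have zm : `|z| < (`|z| + r) / 2 by rewrite midf_lt.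
  have m0 := le_trans (normr_ge0 z) (ltW zm).
  apply: normed_cvg; rewrite -cvgn_seriesS.
  have am : cvgn (pseries a ((`|z| + r) / 2)) by apply: ac; rewrite ger0_norm // midf_lt.
  have := is_cvg_pseries_normed _ _ z am; rewrite (ger0_norm m0) => /(_ zm).
  move=> /(@is_cvg_seriesZ _ _ `|z|) cz.
  apply: (series_le_cvg _ _ _ cz) => n //=; first by rewrite mulr_ge0.
  have -> : `|a n / n.+1%:R * z ^+ n.+1| = `|z| * `|a n * z ^+ n| * n.+1%:R^-1.
    by rewrite !normrM exprS normrM normfV normr_nat; ring.
  rewrite -[leRHS]mulr1 ler_wpM2l ?mulr_ge0 // invf_le1 ?ltr0n //.
  by rewrite ler1n.
exists b => x xr.
suff -> : F (t0 + x) = limn (pseries b x) by exact: bc.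
have b0 : limn (pseries b 0) = F t0.
  apply: cvg_lim => //; rewrite -cvg_shiftS; apply: cvg_near_cst; apply: nearW => n.
  rewrite /pseries /series /= big_nat_recl //= expr0 mulr1 big1 ?addr0 // => i _.
  by rewrite exprS mul0r mulr0.
(* The difference of the two primitives of [h] has zero derivative on the segment from 0 to x and
   vanishes at 0. *)
suff : F (t0 + x) - limn (pseries b x) = F (t0 + 0) - limn (pseries b 0).
  by rewrite b0 addr0 subrr => /subr0_eq.
apply: (@derive0_eq (fun x => F (t0 + x) - limn (pseries b x))) => z zx.
have zr : `|z| < r.
  move: zx xr; rewrite ltr_norml ge_min le_max ltr_norml.
  by move=> /andP[/orP[] ? /orP[] ?] /andP[? ?]; apply/andP; split; lra.
have hE : h (t0 + z) = limn (pseries (pseries_diffs b) z).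
  by rewrite bE; apply/esym/cvg_lim => //; exact: ar.
rewrite -(subrr (h (t0 + z))); apply: is_deriveB; last first.
  by rewrite hE; exact: is_derive_pseries bc zr.
rewrite -[h _]mulr1; apply: (@is_derive1_comp R F (fun z => t0 + z)).
by rewrite -[X in is_derive _ _ _ X]add0r; apply: is_deriveD.
Qed.

Lemma real_analytic_id : real_analyticR (fun t : R => t).
Proof.
exact: real_analytic_primitive (real_analytic_cst 1) (fun t => is_derive_id t 1).
Qed.

End RealAnalytic.

(** * Geometric versus algebraic multiplicity *)

Lemma char_poly_tr (F : fieldType) n (A : 'M[F]_n) :
  char_poly A^T = char_poly A.
Proof.
rewrite /char_poly -[in RHS]det_tr; congr (\det _).
by apply/matrixP => i j; rewrite !mxE eq_sym.
Qed.

(** A basis of the eigenspace is completed to the invertible matrix [L]. The first r rows of L (X -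
    A) are divisible by X - l, so (X - l)^r divides det L times the characteristic polynomial, and
    det L is a nonzero scalar. *)
Lemma rank_eigenspace_le_mup (F : fieldType) n (A : 'M[F]_n) (l : F) :
  (\rank (eigenspace A l) <= mup l (char_poly A))%N.
Proof.
set E := eigenspace A l; set r := \rank E; set L := row_ebase E.
have cp0 : char_poly A != 0 by rewrite monic_neq0 ?char_poly_monic.
have Lrow (i : 'I_n) : (i < r)%N -> row i L *m A = l *: row i L.
  move=> ir; apply/eigenspaceP.
  have -> : row i L = row i (invmx (col_ebase E)) *m E.
    rewrite -row_mul -{2}(mulmx_ebase E) !mulmxA mulVmx ?col_ebase_unit //.
    rewrite mul1mx row_mul -/r -/L.
    suff -> : row i (pid_mx r : 'M[F]_n) = delta_mx 0 i by rewrite -rowE.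
    by apply/rowP => j; rewrite !mxE eqxx ir andbT eq_sym.
  exact: submxMl.
pose p := 'X - l%:P.
(* L (X - A) = diag(d) M, where the first r rows of L are eigenvectors. *)
pose N : 'M[{poly F}]_n := map_mx polyC L *m char_poly_mx A.
pose d : 'rV[{poly F}]_n := \row_i (if (i < r)%N then p else 1).
pose M : 'M[{poly F}]_n := \matrix_(i, j) if (i < r)%N then (L i j)%:P else N i j.
have NE : N = diag_mx d *m M.
  apply/matrixP => i j; rewrite mul_diag_mx !mxE.
  case: ifP => ir; last by rewrite mul1r.
  have /rowP/(_ j) := Lrow i ir; rewrite !mxE => Lij.
  rewrite (eq_bigr (fun s => (L i s)%:P * ('X%:M) s j - (L i s * A s j)%:P)); last first.
    by move=> s _; rewrite !mxE mulrBr polyCM.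
  rewrite sumrB -rmorph_sum /=.
  have -> : \sum_s L i s * A s j = l * L i j.
    by rewrite -Lij; apply: eq_bigr => s _; rewrite mxE.
  rewrite (bigD1 j) //= big1 => [|s sj].
    by rewrite !mxE eqxx mulr1n addr0 polyCM [_ * 'X]mulrC -mulrBl.
  by rewrite !mxE (negbTE sj) mulr0n mulr0.
have prod_d : \det (diag_mx d) = p ^+ r.
  rewrite det_diag; under eq_bigr do rewrite mxE.
  rewrite -big_mkcond /= (big_ord_narrow (rank_leq_row E)) /=.
  by rewrite big_const_ord iter_mulr_1.
have detL : \det L != 0 by rewrite -unitfE -unitmxE row_ebase_unit.
rewrite mup_geq // -/p -(dvdpZr _ _ detL) -mul_polyC.
have -> : (\det L)%:P = \det (map_mx polyC L) by rewrite det_map_mx.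
by rewrite /char_poly -det_mulmx -/N NE det_mulmx prod_d dvdp_mulIl.
Qed.

(** * Simple eigenvectors, the unit circle and the Hermitian product *)

Section Linear.
Variable R : realType.
Local Notation C := R[i].

(** The eigenspace has rank at most one, so [v] spans it. The transpose appears because [eigenspace]
    consists of row vectors. *)
Lemma simple_eigenvector n (A : 'M[C]_n) (l : C) (v w : 'cV[C]_n) :
  simple_eigenvalue A l -> v != 0 -> A *m v = l *: v -> A *m w = l *: w ->
  exists s, w = s *: v.
Proof.
rewrite /simple_eigenvalue -char_poly_tr => As v0 Av Aw.
have rk := rank_eigenspace_le_mup _ _ A^T l; rewrite As in rk.
have in_eig (u : 'cV[C]_n) : A *m u = l *: u -> (u^T <= eigenspace A^T l)%MS.
  by move=> Au; apply/eigenspaceP; rewrite -trmx_mul Au linearZ.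
have eqE : (v^T == eigenspace A^T l)%MS.
  rewrite -(geq_leqif (mxrank_leqif_eq (in_eig v Av))).
  apply: leq_trans rk _; rewrite lt0n mxrank_eq0.
  by apply: contraNneq v0 => /(congr1 trmx); rewrite trmxK trmx0 => ->.
have := in_eig w Aw; rewrite -(eqmxP eqE) => /sub_rVP [s].
by move=> /(congr1 trmx); rewrite linearZ /= !trmxK => ->; exists s.
Qed.

Lemma expiD (s t : R) : expi (s + t) = expi s * expi t.
Proof. by rewrite /expi cosD sinD /GRing.mul /= [X in _ +i* X]addrC. Qed.

Lemma expi0 : expi (0 : R) = 1.
Proof. by rewrite /expi cos0 sin0. Qed.

Lemma expiN (t : R) : expi (- t) = (expi t)^*%R.
Proof. by rewrite /expi cosN sinN. Qed.

Lemma expiNK (t : R) : expi (- t) * expi t = 1.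
Proof. by rewrite -expiD addNr expi0. Qed.

Lemma expiX (t : R) m : expi t ^+ m = expi (m%:R * t).
Proof.
elim: m => [|m IH]; first by rewrite mul0r expi0.
by rewrite exprS IH -natr1 mulrDl mul1r addrC expiD.
Qed.

Section Cdot.
Variable n : nat.
Implicit Types u v w : 'cV[C]_n.

Lemma cdotDl u v w : cdot (u + v) w = cdot u w + cdot v w.
Proof. by rewrite /cdot -big_split; apply: eq_bigr => i _; rewrite mxE mulrDl. Qed.

Lemma cdotZl a u w : cdot (a *: u) w = a * cdot u w.
Proof. by rewrite /cdot mulr_sumr; apply: eq_bigr => i _; rewrite mxE mulrA. Qed.

Lemma cdotBl u v w : cdot (u - v) w = cdot u w - cdot v w.
Proof. by rewrite -scaleN1r cdotDl cdotZl mulN1r. Qed.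

Lemma cdot0l w : cdot 0 w = 0.
Proof. by rewrite -(scale0r 0) cdotZl mul0r. Qed.

Lemma cdot_suml I (r : seq I) (P : pred I) (F : I -> 'cV[C]_n) w :
  cdot (\sum_(i <- r | P i) F i) w = \sum_(i <- r | P i) cdot (F i) w.
Proof. exact: (big_morph (fun u => cdot u w) (fun u v => cdotDl u v w) (cdot0l w)). Qed.

Lemma cdotC u w : cdot u w = (cdot w u)^*%R.
Proof.
rewrite /cdot rmorph_sum; apply: eq_bigr => i _.
by rewrite rmorphM /= conjCK mulrC.
Qed.

Lemma cdotZr a u w : cdot u (a *: w) = a^* * cdot u w.
Proof. by rewrite cdotC cdotZl rmorphM /= -cdotC. Qed.

Lemma cdot_sumr I (r : seq I) (P : pred I) (F : I -> 'cV[C]_n) w :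
  cdot w (\sum_(i <- r | P i) F i) = \sum_(i <- r | P i) cdot w (F i).
Proof.
by rewrite cdotC cdot_suml rmorph_sum; apply: eq_bigr => i _; rewrite /= -cdotC.
Qed.

Lemma cdot_mxadj (A : 'M[C]_n) u w : cdot (mxadj A *m u) w = cdot u (A *m w).
Proof.
rewrite /cdot.
under eq_bigr do rewrite mxE mulr_suml.
rewrite exchange_big; apply: eq_bigr => i _.
rewrite mxE rmorph_sum mulr_sumr; apply: eq_bigr => j _.
by rewrite !mxE rmorphM /= mulrCA mulrA.
Qed.

Lemma cdot_ge0 u : 0 <= cdot u u.
Proof. by apply: sumr_ge0 => i _; rewrite mul_conjC_ge0. Qed.

Lemma cdot_eq0 u : cdot u u = 0 -> u = 0.
Proof.
move/eqP; rewrite psumr_eq0 => [/allP u0|i _]; last exact: mul_conjC_ge0.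
apply/matrixP => i j; rewrite ord1 mxE.
by have := u0 i (mem_index_enum _); rewrite mul_conjC_eq0 => /eqP.
Qed.

End Cdot.
End Linear.

(** * Rotation of the blocks and its effect on [HX] *)

Section BlockRotation.
Variables (R : realType) (n k : nat).
Local Notation C := R[i].
Variables (X : 'M[C]_n) (H : nat -> 'M[C]_n).

(** Fullness writes the identity as a sum of u_m H_m; transposing passes from row spaces to columns.
    Orthogonality of the blocks later makes each [Q m] act as the orthogonal projection. *)
Lemma block_projections : (\sum_(m < k) H m == 1%:M)%MS ->
  exists Q : 'I_k -> 'M[C]_n,
    (forall (m : 'I_k) v, inspace (H m) (Q m *m v)) /\
    (forall v : 'cV[C]_n, \sum_m Q m *m v = v).
Proof.
case/andP => _ /sub_sumsmxP [u u1]; exists (fun m => (u m *m H m)^T); split.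
  move=> m v; rewrite /inspace trmx_mul trmxK mulmxA; exact: submxMl.
by move=> v; rewrite -mulmx_suml -linear_sum -u1 /= trmx1 mul1mx.
Qed.

Variable Q : 'I_k -> 'M[C]_n.

(** The operator D(t) applied to [v], with blocks counted from 0. *)
Definition block_rot (t : R) (v : 'cV[C]_n) : 'cV[C]_n :=
  \sum_(m < k) expi (m%:R * t) *: (Q m *m v).

Hypothesis Horth : forall a b : nat, (a < k)%N -> (b < k)%N -> a <> b ->
  forall u w : 'cV[C]_n, inspace (H a) u -> inspace (H b) w -> cdot u w = 0.
Hypothesis QH : forall (m : 'I_k) (v : 'cV[C]_n), inspace (H m) (Q m *m v).
Hypothesis Qsum : forall v : 'cV[C]_n, \sum_m Q m *m v = v.

Lemma cdot_proj (m j : 'I_k) (v b : 'cV[C]_n) : inspace (H j) b ->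
  cdot (Q m *m v) b = (m == j)%:R * cdot v b.
Proof.
move=> bj; have off (i : 'I_k) : i != j -> cdot (Q i *m v) b = 0.
  move=> ij; apply: (Horth _ _ (ltn_ord i) (ltn_ord j) _ _ _ (QH i v) bj).
  by move/val_inj/eqP; rewrite (negbTE ij).
have [->|/off ->] := eqVneq m j; last by rewrite mul0r.
rewrite mul1r -{2}(Qsum v) cdot_suml (bigD1 j) //= big1 ?addr0 //.
Qed.

Lemma cdot_block_rot t v (j : 'I_k) b : inspace (H j) b ->
  cdot (block_rot t v) b = expi (j%:R * t) * cdot v b.
Proof.
move=> bj; rewrite cdot_suml (bigD1 j) //= big1 => [|i ij].
  by rewrite addr0 cdotZl (cdot_proj j j) // eqxx mul1r.
by rewrite cdotZl (@cdot_proj i j) // (negbTE ij) mul0r mulr0.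
Qed.

(** u - v is orthogonal to each of its own block components, hence to itself. Vector identities thus
    reduce to scalar ones, where D(t) acts on block j by e^{ijt}. *)
Lemma block_ext u v :
  (forall (j : 'I_k) b, inspace (H j) b -> cdot u b = cdot v b) -> u = v.
Proof.
move=> uv; apply/eqP; rewrite -subr_eq0; apply/eqP/cdot_eq0.
rewrite -{2}(Qsum (u - v)) cdot_sumr big1 // => j _.
by rewrite cdotBl (uv j) ?subrr.
Qed.

Lemma block_rotK t v : block_rot (- t) (block_rot t v) = v.
Proof.
apply: block_ext => j b bj; rewrite !(@cdot_block_rot _ _ j) //.
by rewrite mulrA mulrN expiNK mul1r.
Qed.

Lemma block_rotZ t a v : block_rot t (a *: v) = a *: block_rot t v.
Proof.
apply: block_ext => j b bj.
by rewrite cdotZl !(@cdot_block_rot _ _ j) // cdotZl mulrCA.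
Qed.

Lemma cdot_block_rot2 s t v :
  cdot (block_rot s v) (block_rot t v) =
  \sum_(m < k) expi (m%:R * (s - t)) * cdot (Q m *m v) (Q m *m v).
Proof.
rewrite [block_rot t v]/block_rot cdot_sumr; apply: eq_bigr => m _.
rewrite cdotZr (@cdot_block_rot _ _ m) // -(expiN R) (@cdot_proj m m) // eqxx mul1r.
by rewrite mulrA -expiD mulrBr addrC.
Qed.

Hypothesis HX1 : forall v : 'cV[C]_n, inspace (H 0%N) v -> X *m v = 0.
Hypothesis HXs : forall m : nat, (0 < m)%N -> (m < k)%N ->
  forall v : 'cV[C]_n, inspace (H m) v -> inspace (H m.-1) (X *m v).

(** Only the component in block j + 1 is sent by [X] into block j. Block 0 is killed, and the other
    components land in blocks orthogonal to [b]. *)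
Lemma cdot_shift_block_rot t v (j : 'I_k) b : inspace (H j) b ->
  cdot (X *m block_rot t v) b = expi (j.+1%:R * t) * cdot (X *m v) b.
Proof.
move=> bj; rewrite -[in RHS](Qsum v) !mulmx_sumr !cdot_suml mulr_sumr.
apply: eq_bigr => m _; rewrite -scalemxAr cdotZl.
have [->//|mj] := eqVneq (m : nat) j.+1.
suff -> : cdot (X *m (Q m *m v)) b = 0 by rewrite !mulr0.
have [m0|m0] := posnP m.
  by have := QH m v; rewrite m0 => /HX1 ->; rewrite cdot0l.
apply: (@Horth m.-1 j _ (ltn_ord j) _ _ _ (HXs m m0 (ltn_ord m) _ (QH m v)) bj).
  exact: leq_ltn_trans (leq_pred _) (ltn_ord m).
by move=> mj'; rewrite -mj' prednK ?eqxx in mj.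
Qed.

(** The adjoint is moved onto [b], and X b lies in block j - 1. The exponent uses real subtraction;
    for j = 0 both sides vanish since X b = 0. *)
Lemma cdot_adj_block_rot t v (j : 'I_k) b : inspace (H j) b ->
  cdot (mxadj X *m block_rot t v) b =
  expi ((j%:R - 1) * t) * cdot (mxadj X *m v) b.
Proof.
move=> bj; rewrite !cdot_mxadj; have [j0|j0] := posnP j.
  by move: bj; rewrite j0 => /HX1 ->; rewrite ![cdot _ 0]cdotC !cdot0l conjC0 mulr0.
have jk : (j.-1 < k)%N := leq_ltn_trans (leq_pred _) (ltn_ord j).
rewrite (@cdot_block_rot _ _ (Ordinal jk)) //=; last exact: HXs.
by rewrite -[in RHS](prednK j0) -natr1 addrK.
Qed.

(** In block j, the factors e^{-i(s+t)} e^{i(j+1)t} and e^{i(s+t)} e^{i(j-1)t} equal e^{-is} and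
    e^{is} times the common phase e^{ijt}. *)
Lemma HX_block_rot s t v l :
  HX X s *m v = l *: v -> HX X (s + t) *m block_rot t v = l *: block_rot t v.
Proof.
move=> Hv; apply: block_ext => j b bj.
have HXE u r : cdot (HX X r *m u) b = 2^-1 * (expi (- r) * cdot (X *m u) b +
    expi r * cdot (mxadj X *m u) b).
  by rewrite /HX -scalemxAl mulmxDl -!scalemxAl cdotZl cdotDl !cdotZl.
rewrite HXE cdotZl (@cdot_shift_block_rot _ _ j) // (@cdot_adj_block_rot _ _ j) //.
rewrite (@cdot_block_rot _ _ j) //.
have := congr1 (fun u => cdot u b) Hv; rewrite HXE cdotZl => E.
rewrite [RHS]mulrCA -E [RHS]mulrCA; congr (_ * _).
rewrite mulrDr !mulrA -!expiD -natr1; congr (expi _ * _ + expi _ * _); ring.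
Qed.

End BlockRotation.

(** * Analytic lifting of a phase *)

Section ComplexAnalytic.
Local Open Scope classical_set_scope.
Local Open Scope ring_scope.
Local Open Scope complex_scope.
Variable R : realType.
Local Notation C := R[i].

Lemma Re_sum I (r : seq I) (P : pred I) (F : I -> C) :
  complex.Re (\sum_(i <- r | P i) F i) = \sum_(i <- r | P i) complex.Re (F i).
Proof. by apply: (big_morph (@complex.Re R)) => [[x1 x2] [y1 y2]|]. Qed.

Lemma ReMC (z : C) (x : R) : complex.Re (z * x%:C) = complex.Re z * x.
Proof. by case: z => z1 z2; rewrite /GRing.mul /= mulr0 subr0. Qed.

(** The factor [b] covers real parts, imaginary parts (b = -i) and the coefficients of linear
    combinations at once. *)
Lemma real_analytic_Re (b : C) (f : R -> C) :
  real_analyticC f -> real_analyticR (fun t => complex.Re (b * f t)).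
Proof.
move=> fa t0; have [r r0 [a ar]] := fa t0; exists r => //.
exists (fun n => complex.Re (b * a n)) => t tr; have {}ar := ar t tr.
apply/cvgrPdist_lt => e e0.
(* Adding 1 keeps the divisor positive when b = 0. *)
have b0 : 0 < `|b| + 1 :> C by rewrite ltr_wpDl.
have e'0 : 0 < e%:C / (`|b| + 1) :> C by rewrite divr_gt0 // ltcR.
have := (@cvgrPdist_lt (C : numFieldType)
  (C : numFieldType)^o
  _ _ _ _ _).1 ar _ e'0.
case=> N0 _ HN; exists N0 => // N /HN /=; rewrite ltr_pdivlMr // => fN.
rewrite -ltcR; apply: le_lt_trans fN.
set S := \sum_(k < N) a k * _.
have -> : complex.Re (b * f t) - \sum_(k < N) complex.Re (b * a k) * (t - t0) ^+ k =
    complex.Re (b * (f t - S)).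
  under eq_bigr do rewrite -ReMC -mulrA.
  by rewrite -Re_sum -mulr_sumr mulrBr; case: (b * f t) (b * S) => [? ?] [? ?].
apply: le_trans (normc_ge_Re _) _; rewrite normrM mulrC ler_wpM2l //.
by rewrite lerDl.
Qed.

Lemma phase_lift (a b : R -> R) : real_analyticR a -> real_analyticR b ->
  (forall t, a t ^+ 2 + b t ^+ 2 = 1) ->
  exists2 al : R -> R, real_analyticR al &
    forall s t, (a s +i* b s) * (a t +i* b t)^*%R = expi (al s - al t).
Proof.
move=> aa ba ab1.
have [a' a'a aD] := real_analytic_derive _ _ aa.
have [b' b'a bD] := real_analytic_derive _ _ ba.
(* The angular velocity of a + ib on the unit circle. Its primitive is the phase, and the constant
   of integration cancels in phase differences. *)
pose h t := a t * b' t + -1 * (b t * a' t).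
have ha : real_analyticR h.
  apply: real_analyticD; first exact: real_analyticM.
  by apply: real_analyticM (real_analytic_cst _ _) _; exact: real_analyticM.
have hc : continuous h.
  have [h' _ hD] := real_analytic_derive _ _ ha.
  move=> t; apply: differentiable_continuous; apply/derivable1_diffP.
  exact: (@ex_derive _ _ _ _ _ _ _ (hD t)).
have [al alD] := continuous_antiderivative _ _ hc.
exists al; first exact: real_analytic_primitive ha alD.
(* Derivative of a^2 + b^2 = 1. Combined with the definition of [h] it gives b h = -a' and a h = b',
   that is, (a + ib)' = i h (a + ib). *)
have ab' t : a t * a' t + b t * b' t = 0.
  have D : is_derive t 1 (a * a + b * b)
      ((a t *: a' t + a t *: a' t) + (b t *: b' t + b t *: b' t)).
    by apply: is_deriveD; apply: is_deriveM.
  have : a * a + b * b = cst 1 by apply/funext => s; rewrite /cst -(ab1 s) !expr2.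
  move=> E; rewrite E in D; have := @derive_val _ _ _ _ _ _ _ D.
  rewrite derive_cst /GRing.scale /=; lra.
have ca (t : R) : is_derive t 1 (cos \o al) (- sin (al t) * h t).
  by apply: is_derive1_comp.
have sa (t : R) : is_derive t 1 (sin \o al) (cos (al t) * h t) by apply: is_derive1_comp.
pose g1 := a * (cos \o al) + b * (sin \o al).
pose g2 := b * (cos \o al) - a * (sin \o al).
have bh t : b t * h t = - a' t.
  rewrite /h; have := ab1 t; have := ab' t.
  move: (a t) (b t) (a' t) (b' t) => x y x' y' E1 E2.
  have -> : y * (x * y' + -1 * (y * x')) =
      x * (x * x' + y * y') - x' * (x ^+ 2 + y ^+ 2) by ring.
  by rewrite E1 E2 mulr0 mulr1 sub0r.
have ah t : a t * h t = b' t.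
  rewrite /h; have := ab1 t; have := ab' t.
  move: (a t) (b t) (a' t) (b' t) => x y x' y' E1 E2.
  have -> : x * (x * y' + -1 * (y * x')) =
      y' * (x ^+ 2 + y ^+ 2) - y * (x * x' + y * y') by ring.
  by rewrite E1 E2 mulr0 mulr1 subr0.
(* g1 + i g2 = (a + i b) e^{-i al} has zero derivative. *)
have g1c s t : g1 s = g1 t.
  apply: is_derive_0_is_cst => x.
  have -> : 0 = (a x *: (- sin (al x) * h x) + cos (al x) *: a' x) +
      (b x *: (cos (al x) * h x) + sin (al x) *: b' x).
    rewrite /GRing.scale /=.
    have -> : b x * (cos (al x) * h x) = cos (al x) * (b x * h x) by ring.
    have -> : a x * (- sin (al x) * h x) = - sin (al x) * (a x * h x) by ring.
    by rewrite ah bh; ring.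
  by apply: is_deriveD; apply: is_deriveM.
have g2c s t : g2 s = g2 t.
  apply: is_derive_0_is_cst => x.
  have -> : 0 = (b x *: (- sin (al x) * h x) + cos (al x) *: b' x) -
      (a x *: (cos (al x) * h x) + sin (al x) *: a' x).
    rewrite /GRing.scale /=.
    have -> : a x * (cos (al x) * h x) = cos (al x) * (a x * h x) by ring.
    have -> : b x * (- sin (al x) * h x) = - sin (al x) * (b x * h x) by ring.
    by rewrite ah bh; ring.
  by apply: is_deriveB; apply: is_deriveM.
pose u t : C := a t +i* b t.
have uE t : u t * expi (- al t) = g1 t +i* g2 t.
  rewrite /u /expi cosN sinN /GRing.mul /=; congr (_ +i* _);
    by rewrite /g1 /g2 !fctE /=; ring.
have uu t : u t * (u t)^*%R = 1.
  rewrite /u /GRing.mul /=; apply/eqP; rewrite eq_complex /=; apply/andP; split.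
    by rewrite mulrN opprK -!expr2 ab1.
  by apply/eqP; ring.
move=> s t; rewrite -/(u s) -/(u t).
have -> : u s = u t * expi (al s - al t).
  have E : u s * expi (- al s) = u t * expi (- al t).
    by rewrite !uE (g1c s t) (g2c s t).
  by rewrite addrC expiD mulrA -E -mulrA expiNK mulr1.
by rewrite mulrAC uu mul1r.
Qed.

End ComplexAnalytic.

(* Blocks H_1, ..., H_k of the paper are H 0, ..., H (k-1) here (row spaces of matrices);
   the coefficient c_m^{(j)} of the paper is c (m-1), so p_j(z) = \sum_{m<k} c m z^m. *)
Theorem mainTheorem15 (R : realType) (n k : nat) (X : 'M[R[i]]_n)
  (H : nat -> 'M[R[i]]_n)
  (Xirr : unitarily_irreducible X)
  (Xrot : rotationally_invariant X)
  (Hfull : (\sum_(m < k) H m == 1%:M)%MS)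
  (Horth : forall a b : nat, (a < k)%N -> (b < k)%N -> a <> b ->
     forall u w : 'cV[R[i]]_n, inspace (H a) u -> inspace (H b) w -> cdot u w = 0)
  (HX1 : forall v : 'cV[R[i]]_n, inspace (H 0%N) v -> X *m v = 0)
  (HXs : forall m : nat, (0 < m)%N -> (m < k)%N ->
     forall v : 'cV[R[i]]_n, inspace (H m) v -> inspace (H m.-1) (X *m v))
  (lambda : R[i]) (theta0 : R)
  (Hsimple : simple_eigenvalue (HX X theta0) lambda)
  (y : R -> 'cV[R[i]]_n)
  (Heig : forall t : R, HX X t *m y t = lambda *: y t)
  (Hunit : forall t : R, cdot (y t) (y t) = 1)
  (Hana : real_analyticV y) :
  exists c : nat -> R,
    (forall m : nat, 0 <= c m) /\ \sum_(m < k) c m = 1 /\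
    exists psi : R -> R, real_analyticR psi /\
      forall theta phi : R,
        cdot (y theta) (y phi) =
          (\sum_(m < k) (c m)%:C * expi (phi - theta) ^+ m) *
          expi (psi phi - psi theta).
Proof.
have [Q [QH Qsum]] := block_projections _ _ _ _ Hfull.
pose rot := block_rot _ _ _ Q; pose y0 := y theta0.
have y00 : y0 != 0.
  apply/eqP => y0E; have := Hunit theta0; rewrite -/y0 y0E cdot0l => /eqP.
  by rewrite eq_sym oner_eq0.
(* Rotating y(t) by theta0 - t gives an eigenvector at theta0, hence a multiple of [y0] by
   simplicity. The scalars come from choice, so their regularity has to be recovered later. *)
have /boolp.choice [s sE] : forall t, exists s, y t = s *: rot (t - theta0) y0.
  move=> t.
  have := HX_block_rot _ _ _ _ _ _ Horth QH Qsum HX1 HXs t (theta0 - t) _ _ (Heig t).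
  rewrite addrC subrK => rot_eig.
  have [s rE] := simple_eigenvector _ _ _ _ _ _ Hsimple y00 (Heig theta0) rot_eig.
  exists s; rewrite /rot -(block_rotZ _ _ _ _ _ Horth QH Qsum) -rE -opprB.
  by rewrite (block_rotK _ _ _ _ _ Horth QH Qsum).
pose d (m : 'I_k) := complex.Re (cdot (Q m *m y0) (Q m *m y0)).
have dE m : cdot (Q m *m y0) (Q m *m y0) = (d m)%:C.
  by rewrite /d RRe_real // ger0_real ?cdot_ge0.
have d0 m : 0 <= d m by rewrite -lecR -dE cdot_ge0.
have rotE a b : cdot (rot a y0) (rot b y0) =
    \sum_(m < k) expi (m%:R * (a - b)) * (d m)%:C.
  rewrite (cdot_block_rot2 _ _ _ _ _ Horth QH Qsum).
  by apply: eq_bigr => m _; rewrite dE.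
have y0Q m : cdot y0 (Q m *m y0) = (d m)%:C.
  by rewrite -dE (cdot_proj _ _ _ _ _ Horth QH Qsum m m) // eqxx mul1r.
have d1C : \sum_m (d m)%:C = 1 :> R[i].
  rewrite -(Hunit theta0) -/y0 -{2}(Qsum y0) cdot_sumr.
  by apply: eq_bigr => m _; rewrite y0Q.
have d1 : \sum_m d m = 1 by apply/complexI; rewrite rmorph_sum.
have yE t t' : cdot (y t) (y t') =
    s t * (s t')^*%R * \sum_(m < k) expi (m%:R * (t - t')) * (d m)%:C.
  rewrite !sE cdotZl cdotZr rotE mulrA.
  by have -> : t - theta0 - (t' - theta0) = t - t' by ring.
(* The case t' = t of [yE], where the weights sum to 1. *)
have ss t : s t * (s t)^*%R = 1.
  have := yE t t; rewrite Hunit subrr => ->.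
  by under eq_bigr do rewrite mulr0 expi0 mul1r; rewrite d1C mulr1.
have [j dj] : exists j, d j != 0.
  apply/existsP; apply: contra_eqT d1 => /existsPn dz.
  rewrite big1 1?eq_sym ?oner_eq0 // => m _.
  by apply/eqP; have := dz m; rewrite negbK.
pose u t := s t * expi (j%:R * (t - theta0)).
(* Pairing y(t) with Q_j y0 gives u(t) d_j, so [u] is a combination of the coordinates of y with the
   constant coefficients [q]. *)
pose q l : R[i] := ((Q j *m y0) l 0)^*%R / (d j)%:C.
have uE t : u t = \sum_l q l * y t l 0.
  have djC : (d j)%:C != 0 :> R[i] by rewrite (inj_eq (@complexI _)).
  transitivity (cdot (y t) (Q j *m y0) / (d j)%:C).
    rewrite sE cdotZl (cdot_block_rot _ _ _ _ _ Horth QH Qsum _ _ j) // y0Q.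
    by rewrite mulrA mulfK.
  by rewrite /cdot mulr_suml; apply: eq_bigr => l _; rewrite /q [RHS]mulrC mulrA.
have uu t : u t * (u t)^*%R = 1.
  by rewrite /u rmorphM /= mulrACA ss mul1r -expiN mulrC expiNK.
have u_ana (b : R[i]) : real_analyticR (fun t => complex.Re (b * u t)).
  apply: (@real_analytic_ext _ (fun t => \sum_l complex.Re ((b * q l) * y t l 0))).
    by move=> t; rewrite uE mulr_sumr Re_sum; apply: eq_bigr => l _; rewrite mulrA.
  by apply: real_analytic_sum => l; exact: real_analytic_Re (Hana l).
have [al al_ana alE] : exists2 al : R -> R, real_analyticR al &
    forall t t', u t * (u t')^*%R = expi (al t - al t').
  have Re_u : real_analyticR (fun t => complex.Re (u t)).
    by apply: real_analytic_ext (u_ana 1) => t; rewrite mul1r.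
  have Im_u : real_analyticR (fun t => complex.Im (u t)).
    apply: real_analytic_ext (u_ana (- 'i%C)) => t.
    by rewrite mulNr raddfN /= mulrC ReiNIm opprK.
  have [t|al al_ana alE] := phase_lift _ _ _ Re_u Im_u.
    have := congr1 (@complex.Re R) (uu t); case: (u t) => [p r] /= <-.
    by rewrite mulrN opprK -!expr2.
  by exists al => // t t'; rewrite -alE; case: (u t) (u t') => [? ?] [? ?].
have sstE t t' : s t * (s t')^*%R = expi (al t - al t' + j%:R * (t' - t)).
  rewrite expiD -alE /u rmorphM /= -expiN mulrACA -[RHS]mulrA -!expiD.
  rewrite -[LHS]mulr1 -(expi0 R); congr (_ * expi _); ring.
(* Reversed weights: c_m = d_{k-1-m} for m < k. For larger m the truncated subtraction gives index
   0, so the value is d_0; the default 0 occurs only if k = 0. Nonnegativity holds in every case. *)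
pose c m := oapp d 0 (insub (k - m.+1)%N : option 'I_k).
exists c; split; first by move=> m; rewrite /c; case: insub.
have cE (i : 'I_k) : c (rev_ord i) = d i.
  by rewrite /c; have /(congr1 val) /= -> := rev_ordK i; rewrite valK.
split.
  by rewrite -d1 (reindex_inj rev_ord_inj); apply: eq_bigr => i _; rewrite cE.
(* The term j t undoes the factor e^{ij(t - theta0)} built into [u], and -(k-1) t absorbs the
   reversal of powers. *)
exists (fun t => -1 * al t + (j%:R - (k%:R - 1)) * t); split.
  apply: real_analyticD; apply: real_analyticM => //; try exact: real_analytic_cst.
  exact: real_analytic_id.
move=> t t'; rewrite yE sstE [in RHS](reindex_inj rev_ord_inj) mulr_sumr mulr_suml.
apply: eq_bigr => i _; rewrite cE expiX /= natrB // -natr1.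
rewrite mulrA -expiD mulrC -mulrA -expiD; congr (_ * expi _); ring.
Qed.
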